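(* Let $q\in\mathbb{C}^*$ be generic. A PBW basis for the moduli algebra $A_{\Sigma_{1,1}}$ of the punctured torus is $$\{(a^1_1)^{\alpha_1}(a^1_2)^{\beta_1}(a^2_1)^{\gamma_1}(a^2_2)^{\delta_1}(b^1_1)^{\alpha_2}(b^1_2)^{\beta_2}(b^2_1)^{\gamma_2}(b^2_2)^{\delta_2}\mid\alpha_i,\beta_i,\gamma_i,\delta_i\in\mathbb{N}_0,\ \beta_i=0\text{ or }\gamma_i=0\text{ for each }i=1,2\}.$$
   Context: A PBW basis here is in particular a $\mathbb{C}$-vector space basis. All tensor indices range over $\{1,2\}$; a square root $q^{1/2}$ is fixed. $A_{\Sigma_{1,1}}$ is the $\mathbb{C}$-algebra with generators $a^i_j,b^i_j$ and the following relations. (1) For each letter $x\in\{a,b\}$: $x^1_2x^1_1=x^1_1x^1_2+(1-q^{-2})x^1_2x^2_2$; $x^2_1x^1_1=x^1_1x^2_1-q^{-2}(1-q^{-2})x^2_1x^2_2$; $x^2_1x^1_2=x^1_2x^2_1+(1-q^{-2})(x^1_1x^2_2-x^2_2x^2_2)$; $x^2_2x^1_1=x^1_1x^2_2$; $x^2_2x^1_2=q^2x^1_2x^2_2$; $x^2_2x^2_1=q^{-2}x^2_1x^2_2$; $x^1_1x^2_2=1+q^2x^1_2x^2_1$. (2) $b^g_ha^e_f=\sum_{i,j,k,l,m,n,o,p}\tilde R^{ie}_{hj}R^{gj}_{kl}R^{mn}_{if}(R^{-1})^{ko}_{pn}\,a^l_ob^p_m$, where the nonzero entries are $R^{11}_{11}=R^{22}_{22}=q^{1/2}q$,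 $R^{12}_{12}=R^{21}_{21}=q^{1/2}$, $R^{21}_{12}=q^{1/2}(q-q^{-1})$; $(R^{-1})^{11}_{11}=(R^{-1})^{22}_{22}=q^{-1/2}q^{-1}$, $(R^{-1})^{12}_{12}=(R^{-1})^{21}_{21}=q^{-1/2}$, $(R^{-1})^{21}_{12}=-q^{-1/2}(q-q^{-1})$; $\tilde R^{11}_{11}=\tilde R^{22}_{22}=q^{-1/2}q^{-1}$, $\tilde R^{12}_{12}=\tilde R^{21}_{21}=q^{-1/2}$, $\tilde R^{21}_{12}=q^{-1/2}q^{-2}(q^{-1}-q)$. The underlying vector space is $\mathcal{O}_q(\mathrm{SL}_2)^{\otimes2}$, where $\mathcal{O}_q(\mathrm{SL}_2)$ is the algebra defined by relations (1) for a single letter. *)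

(* Defs.v *)
From HB Require Import structures.
From mathcomp Require Import all_boot all_order all_algebra.
From mathcomp Require Import boolp reals.
From mathcomp Require Import complex.
From mathcomp Require Import ring_quotient generic_quotient.
From mathcomp.multinomials Require Import monalg.

Set Implicit Arguments.
Unset Strict Implicit.
Unset Printing Implicit Defensive.

Import GRing.Theory.
Local Open Scope ring_scope.
Local Open Scope quotient_scope.

(* The free associative unital K-algebra on G is the monoid algebra of the
   free monoid on G. *)
Notation free_alg K G := {malg K[{fmonom G}]}.

Definition free_gen (K : comNzRingType) (G : choiceType) (g : G) : free_alg K G :=
  << fmu g >>.

Lemma free_scalerAr (K : comNzRingType) (G : choiceType) c (u v : free_alg K G) :
  c *: (u * v) = u * (c *: v).
Proof.
have cC (w : free_alg K G) : w * c%:MP = c%:MP * w.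
  rewrite mul_malgC [LHS]fgmulgU malgZ_def.
  by apply: eq_bigr => k _; rewrite mulm1 mulrC.
by rewrite -!mul_malgC !mulrA cC.
Qed.

Section PresentedAlgebra.
Variables (K : comNzRingType) (G : choiceType).
Local Notation F := (free_alg K G).
Variable rel : F -> F -> Prop.

Inductive in_ideal : F -> Prop :=
| in_ideal_rel u v : rel u v -> in_ideal (u - v)
| in_ideal0 : in_ideal 0
| in_idealD u v : in_ideal u -> in_ideal v -> in_ideal (u + v)
| in_idealMl w u : in_ideal u -> in_ideal (w * u)
| in_idealMr w u : in_ideal u -> in_ideal (u * w).

Definition rel_ideal : {pred F} := [pred u | `[< in_ideal u >]].

Lemma rel_idealP u : reflect (in_ideal u) (u \in rel_ideal).
Proof. exact: asboolP. Qed.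

Fact rel_ideal_zmod_closed : zmod_closed rel_ideal.
Proof.
split=> [|u v /rel_idealP Iu /rel_idealP Iv]; apply/rel_idealP.
  exact: in_ideal0.
by apply: in_idealD => //; rewrite -mulN1r; apply: in_idealMl.
Qed.
HB.instance Definition _ := GRing.isZmodClosed.Build F rel_ideal
  rel_ideal_zmod_closed.

(* The quotient is not given an algType structure, because MathComp's algebras
   are nontrivial by definition, and 1 may lie in the ideal. *)
Definition presented := Quotient.quot rel_ideal.
HB.instance Definition _ := GRing.Zmodule.on presented.
HB.instance Definition _ := EqQuotient.on presented.

Definition proj (u : F) : presented := \pi_presented u.

Lemma projE u v : (proj u == proj v) = (u - v \in rel_ideal).
Proof. by rewrite Quotient.idealrBE. Qed.

Lemma proj_eq u v : rel u v -> proj u = proj v.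
Proof. by move=> uv; apply/eqP; rewrite projE; apply/rel_idealP/in_ideal_rel. Qed.

Lemma repr_proj u : repr (proj u) - u \in rel_ideal.
Proof. by rewrite -projE /proj reprK. Qed.

Lemma projK (x : presented) : proj (repr x) = x.
Proof. exact: reprK. Qed.

Lemma projD u v : proj (u + v) = proj u + proj v.
Proof. exact: (@pi_addr _ _ _ _ _ (Quotient.quot rel_ideal)). Qed.

Definition pres_one : presented := proj 1.
Definition pres_mul (x y : presented) : presented := proj (repr x * repr y).
Definition pres_scale (c : K) (x : presented) : presented := proj (c *: repr x).

Lemma proj_pres_mul u v : proj (u * v) = pres_mul (proj u) (proj v).
Proof.
apply/esym/eqP; rewrite projE.
have -> : repr (proj u) * repr (proj v) - u * v =
   (repr (proj u) - u) * repr (proj v) + u * (repr (proj v) - v).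
  by rewrite mulrBl mulrBr addrA subrK.
apply/rel_idealP/in_idealD.
  exact/in_idealMr/rel_idealP/repr_proj.
exact/in_idealMl/rel_idealP/repr_proj.
Qed.

Lemma proj_pres_scale c u : proj (c *: u) = pres_scale c (proj u).
Proof.
apply/esym/eqP; rewrite projE -scalerBr -[_ - _]mul1r scalerAl.
exact/rel_idealP/in_idealMl/rel_idealP/repr_proj.
Qed.

Lemma pres_mulA : associative pres_mul.
Proof.
by move=> x y z; rewrite -[x]projK -[y]projK -[z]projK -!proj_pres_mul mulrA.
Qed.

Lemma pres_mul1 : left_id pres_one pres_mul.
Proof. by move=> x; rewrite -[x]projK -proj_pres_mul mul1r. Qed.

Lemma pres_mulr1 : right_id pres_one pres_mul.
Proof. by move=> x; rewrite -[x]projK -proj_pres_mul mulr1. Qed.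

Lemma pres_mulDl : left_distributive pres_mul +%R.
Proof.
by move=> x y z; rewrite -[x]projK -[y]projK -[z]projK -!(proj_pres_mul, projD) mulrDl.
Qed.

Lemma pres_mulDr : right_distributive pres_mul +%R.
Proof.
by move=> x y z; rewrite -[x]projK -[y]projK -[z]projK -!(proj_pres_mul, projD) mulrDr.
Qed.

HB.instance Definition _ := GRing.Zmodule_isPzRing.Build presented
  pres_mulA pres_mul1 pres_mulr1 pres_mulDl pres_mulDr.

Lemma pres_scaleA c d x : pres_scale c (pres_scale d x) = pres_scale (c * d) x.
Proof. by rewrite -[x]projK -!proj_pres_scale scalerA. Qed.

Lemma pres_scale1 : left_id 1 pres_scale.
Proof. by move=> x; rewrite -[x]projK -proj_pres_scale scale1r. Qed.

Lemma pres_scaleDr : right_distributive pres_scale +%R.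
Proof.
by move=> c x y; rewrite -[x]projK -[y]projK -!(proj_pres_scale, projD) scalerDr.
Qed.

Lemma pres_scaleDl x : {morph pres_scale^~ x : c d / c + d}.
Proof. by move=> c d; rewrite -[x]projK -!(proj_pres_scale, projD) scalerDl. Qed.

HB.instance Definition _ := GRing.Zmodule_isLmodule.Build K presented
  pres_scaleA pres_scale1 pres_scaleDr pres_scaleDl.

Lemma projM u v : proj (u * v) = proj u * proj v.
Proof. exact: proj_pres_mul. Qed.

Lemma projZ c u : proj (c *: u) = c *: proj u.
Proof. exact: proj_pres_scale. Qed.

Lemma proj1 : proj 1 = 1.
Proof. by []. Qed.

Lemma pres_scaleAl c (x y : presented) : c *: (x * y) = (c *: x) * y.
Proof.
rewrite -[x]projK -[y]projK; set u := repr x; set v := repr y.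
by rewrite -[proj u * _]projM -[LHS]projZ -[c *: proj u]projZ -[RHS]projM scalerAl.
Qed.

Lemma pres_scaleAr c (x y : presented) : c *: (x * y) = x * (c *: y).
Proof.
rewrite -[x]projK -[y]projK; set u := repr x; set v := repr y.
by rewrite -[proj u * proj v]projM -[LHS]projZ -[c *: proj v]projZ -[RHS]projM
  free_scalerAr.
Qed.

End PresentedAlgebra.

Section Basis.
Variables (K : nzRingType) (V : lmodType K) (I : choiceType) (e : I -> V).

Definition lin_indep : Prop :=
  forall (s : seq I) (c : I -> K), uniq s ->
    \sum_(i <- s) c i *: e i = 0 -> forall i, i \in s -> c i = 0.

Definition spanning : Prop :=
  forall v : V, exists (s : seq I) (c : I -> K), v = \sum_(i <- s) c i *: e i.

Definition is_basis : Prop := lin_indep /\ spanning.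

End Basis.

Section TorusAlgebra.
Variable K : fieldType.
(* sq is the chosen square root of q. *)
Variables q sq : K.

Local Notation "1'" := (ord0 : 'I_2).
Local Notation "2'" := (ord_max : 'I_2).

(* T i j k l stands for $T^{ij}_{kl}$, with entries d on $T^{11}_{11}$ and
   $T^{22}_{22}$, o on $T^{12}_{12}$ and $T^{21}_{21}$, and e on $T^{21}_{12}$. *)
Definition tensor4 (d o e : K) (i j k l : 'I_2) : K :=
  if (i == k) && (j == l) then if i == j then d else o
  else if [&& i == 2', j == 1', k == 1' & l == 2'] then e else 0.

Definition Rmat := tensor4 (sq * q) sq (sq * (q - q^-1)).
Definition Rinv := tensor4 (sq^-1 * q^-1) sq^-1 (- (sq^-1 * (q - q^-1))).
Definition Rtld := tensor4 (sq^-1 * q^-1) sq^-1 (sq^-1 * q ^- 2 * (q^-1 - q)).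

(* The pair (false, (i, j)) indexes $a^i_j$, and (true, (i, j)) indexes
   $b^i_j$. *)
Definition torus_gen : choiceType := (bool * ('I_2 * 'I_2))%type.
Local Notation F := (free_alg K torus_gen).

Definition fa (i j : 'I_2) : F := free_gen K ((false, (i, j)) : torus_gen).
Definition fb (i j : 'I_2) : F := free_gen K ((true, (i, j)) : torus_gen).

Inductive sl2_rel (x : 'I_2 -> 'I_2 -> F) : F -> F -> Prop :=
| sl2_rel_12_11 : sl2_rel x (x 1' 2' * x 1' 1')
    (x 1' 1' * x 1' 2' + (1 - q ^- 2) *: (x 1' 2' * x 2' 2'))
| sl2_rel_21_11 : sl2_rel x (x 2' 1' * x 1' 1')
    (x 1' 1' * x 2' 1' - (q ^- 2 * (1 - q ^- 2)) *: (x 2' 1' * x 2' 2'))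
| sl2_rel_21_12 : sl2_rel x (x 2' 1' * x 1' 2')
    (x 1' 2' * x 2' 1' +
     (1 - q ^- 2) *: (x 1' 1' * x 2' 2' - x 2' 2' * x 2' 2'))
| sl2_rel_22_11 : sl2_rel x (x 2' 2' * x 1' 1') (x 1' 1' * x 2' 2')
| sl2_rel_22_12 : sl2_rel x (x 2' 2' * x 1' 2') (q ^+ 2 *: (x 1' 2' * x 2' 2'))
| sl2_rel_22_21 : sl2_rel x (x 2' 2' * x 2' 1') (q ^- 2 *: (x 2' 1' * x 2' 2'))
| sl2_rel_det : sl2_rel x (x 1' 1' * x 2' 2')
    (1 + q ^+ 2 *: (x 1' 2' * x 2' 1')).

Inductive torus_rel : F -> F -> Prop :=
| torus_rel_a u v : sl2_rel fa u v -> torus_rel u v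
| torus_rel_b u v : sl2_rel fb u v -> torus_rel u v
| torus_rel_ba g h e f : torus_rel (fb g h * fa e f)
    (\sum_i \sum_j \sum_k \sum_l \sum_m \sum_n \sum_o \sum_p
       (Rtld i e h j * Rmat g j k l * Rmat m n i f * Rinv k o p n)
         *: (fa l o * fb p m)).

Definition A_torus := presented torus_rel.
HB.instance Definition _ := GRing.PzRing.on A_torus.
HB.instance Definition _ := GRing.Lmodule.on A_torus.

Definition gen_a (i j : 'I_2) : A_torus := proj torus_rel (fa i j).
Definition gen_b (i j : 'I_2) : A_torus := proj torus_rel (fb i j).

(* An exponent n stands for $(\alpha,\beta,\gamma,\delta)$. *)
Definition sl2_exponent :=
  {n : nat * nat * nat * nat | (n.1.1.2 == 0) || (n.1.2 == 0)}%N.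

Definition sl2_monomial (x : 'I_2 -> 'I_2 -> A_torus) (n : sl2_exponent) :=
  let: (alpha, beta, gamma, delta) := val n in
  x 1' 1' ^+ alpha * x 1' 2' ^+ beta * x 2' 1' ^+ gamma * x 2' 2' ^+ delta.

Definition pbw_monomial (n : sl2_exponent * sl2_exponent) : A_torus :=
  sl2_monomial gen_a n.1 * sl2_monomial gen_b n.2.

End TorusAlgebra.

Definition generic (K : fieldType) (q : K) : Prop :=
  forall n : nat, (0 < n)%N -> q ^+ n != 1.

(* Main.v *)
From HB Require Import structures.
Require Import Defs.
From mathcomp Require Import all_boot all_order all_algebra.
From mathcomp Require Import boolp reals complex finmap zify ring.
From mathcomp.multinomials Require Import monalg.
Import GRing.Theory.
Local Open Scope ring_scope.
Local Open Scope complex_scope.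

Set Implicit Arguments.
Unset Strict Implicit.
Unset Printing Implicit Defensive.

(* Bergman's diamond lemma. Every defining relation is read as a rule rewriting a
   word of length two, with the determinant relation oriented as
   x12 x21 -> q^-2 (x11 x22 - 1). The irreducible words are exactly the PBW
   monomials, the rules terminate, and all overlaps of length three are resolved
   by a computation over Z[q, q^-1]; this holds for every nonzero q. The normal
   form is then a well-defined linear map that vanishes on the ideal of relations
   and fixes the irreducible words. *)

(** * Rewriting in free algebras *)

(** The basis bans [12] and [21] of the same family, [a] or [b], from occurring together, so both
    orders of this pair must be reducible: this forces [12 21] to be the leading word of the
    determinant relation, and it creates overlaps such as [12 21 11] and [21 12 21] on top of those
    of plain reordering. A degree-lexicographic order read from the left cannot prove termination:
    [12 11] yields [12 22], which asks for [22] below [11], while [22 11] yields [11 22], which asks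
    for the opposite. The numerical measure used instead also supplies the fuel for the recursion
    that computes normal forms. The normal form follows the leftmost redex only, whereas the ideal
    allows a relation at any place of a word; reconciling the two is the core of the argument. *)

Section Span.
Variables (K : nzRingType) (V : lmodType K) (I : choiceType) (e : I -> V).

(** Indices may repeat, so sums are handled by concatenating lists; [in_span_spanning] collects the
    repetitions at the end. *)
Definition in_span (v : V) : Prop :=
  exists t : seq (K * I), v = \sum_(p <- t) p.1 *: e p.2.

Lemma in_span_gen i : in_span (e i).
Proof. by exists [:: (1, i)]; rewrite big_seq1 scale1r. Qed.

Lemma in_spanZ c v : in_span v -> in_span (c *: v).
Proof.
move=> [t ->]; exists [seq (c * p.1, p.2) | p <- t].
by rewrite big_map scaler_sumr; apply: eq_bigr => p _; rewrite scalerA.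
Qed.

Lemma in_span_sum (T : eqType) (s : seq T) (E : T -> V) :
  (forall i, i \in s -> in_span (E i)) -> in_span (\sum_(i <- s) E i).
Proof.
elim: s => [|i s IH] sE; first by exists [::]; rewrite !big_nil.
have [t et] := sE i (mem_head i s).
have [t' et'] : in_span (\sum_(j <- s) E j).
  by apply: IH => j js; apply: sE; rewrite inE js orbT.
by exists (t ++ t'); rewrite big_cons big_cat et et'.
Qed.

Lemma in_span_spanning : (forall v, in_span v) -> spanning e.
Proof.
move=> sp v; have [t ->] := sp v.
exists (undup (map snd t)), (fun i => \sum_(p <- t | p.2 == i) p.1).
under [RHS]eq_bigr do rewrite scaler_suml big_mkcond.
rewrite exchange_big /=; apply: eq_big_seq => p pt.
rewrite -big_mkcond (big_rem p.2) /=; last by rewrite mem_undup map_f.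
rewrite eqxx big_seq_cond big1 ?addr0 // => i /andP[+ /eqP ei].
by rewrite -ei mem_rem_uniqF // undup_uniq.
Qed.

End Span.

Section Words.
Variables (K : comNzRingType) (G : choiceType).
Local Notation F := (free_alg K G).

Definition word_elt (w : seq G) : F := << FMonom w >>.

Lemma word_elt_cat u v : word_elt (u ++ v) = word_elt u * word_elt v.
Proof.
rewrite /word_elt malgM_def fgmulUU mulr1; congr << _ >>.
by apply/val_inj; rewrite /= fmM.
Qed.

Lemma word_elt0 : word_elt [::] = 1.
Proof.
rewrite /word_elt -mpolyC1E.
have -> // : FMonom [::] = mone :> {fmonom G} by apply/val_inj/esym/fm1.
Qed.

Lemma free_genE g : free_gen K g = word_elt [:: g].
Proof. by rewrite /free_gen fmuE. Qed.

Lemma word_elt_expand (u : F) :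
  u = \sum_(m <- msupp u) u@_m *: word_elt (fmonom_val m).
Proof.
rewrite [LHS]monalgE; apply: eq_bigr => -[m] _ /=.
by rewrite -mul_malgC malgM_def fgmulUU mulr1 mul1m.
Qed.

End Words.
Arguments word_elt K {G} w.

(** * Leftmost reduction, normal forms and the diamond lemma *)

Section Rewriting.
Variables (K : comNzRingType) (G : choiceType).
Local Notation F := (free_alg K G).
(** Coefficients stay symbolic in [C] and enter [K] only through [ev], so that reductions can be run
    by computation. [C] has no addition: like terms are left uncollected in the lists. *)
Variables (C : eqType) (mulc : C -> C -> C) (ev : C -> K).
Hypothesis evM : forall c d, ev (mulc c d) = ev c * ev d.

Local Notation lincomb := (seq (C * seq G)).
Variable rule : G -> G -> option lincomb.

Definition lc_scale (c : C) (t : lincomb) : lincomb :=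
  [seq (mulc c p.1, p.2) | p <- t].
Definition lc_ctx (A B : seq G) (t : lincomb) : lincomb :=
  [seq (p.1, A ++ p.2 ++ B) | p <- t].
Definition lc_eval (t : lincomb) : F := \sum_(p <- t) ev p.1 *: word_elt K p.2.

Fixpoint reduce_word (w : seq G) : option lincomb :=
  if w isn't x :: w' then None else
  if w' isn't y :: B then None else
  if rule x y is Some f then Some (lc_ctx [::] B f)
  else omap (lc_ctx [:: x] [::]) (reduce_word w').

Definition reduce_lc (t : lincomb) : lincomb :=
  flatten [seq if reduce_word p.2 is Some s then lc_scale p.1 s else [:: p]
          | p <- t].

Definition irreducible_word w := reduce_word w == None.

Lemma lc_ctx_comp A B A' B' t :
  lc_ctx A B (lc_ctx A' B' t) = lc_ctx (A ++ A') (B' ++ B) t.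
Proof. by rewrite /lc_ctx -map_comp; apply: eq_map => p /=; rewrite -!catA. Qed.

Lemma reduce_word_redex A x y B f : rule x y = Some f ->
  exists A' x' y' B' f',
    [/\ rule x' y' = Some f', reduce_word (A ++ x :: y :: B) = Some (lc_ctx A' B' f') &
     [\/ [/\ A = A', x = x', y = y' & B = B'],
         [/\ A = rcons A' x', y' = x & B' = y :: B] |
         exists D, A = A' ++ x' :: y' :: D /\ B' = D ++ x :: y :: B]].
Proof.
move=> rf; elim: A => [|a A IH].
  by exists [::], x, y, B, f; split=> //=; [rewrite rf | constructor 1].
have [b [V eV]] : exists b V, A ++ x :: y :: B = b :: V.
  by case: (A) => [|b A'] /=; [exists x, (y :: B) | exists b, (A' ++ x :: y :: B)].
case rab: (rule a b) => [g|].
  exists [::], a, b, V, g; split=> //=; first by rewrite eV rab.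
  case: A eV {IH} => [|b' A] /= [<- <-]; first by constructor 2.
  by constructor 3; exists A.
have [A' [x' [y' [B' [f' [rf' ew H]]]]]] := IH.
exists (a :: A'), x', y', B', f'; split=> //=.
  by rewrite eV rab -eV ew /= lc_ctx_comp cats0.
case: H => [[-> -> -> ->]|[-> -> ->]|[D [-> ->]]]; first by constructor 1.
  by constructor 2.
by constructor 3; exists D.
Qed.

Lemma reduce_wordE w t : reduce_word w = Some t ->
  exists A x y B f, [/\ w = A ++ x :: y :: B, rule x y = Some f & t = lc_ctx A B f].
Proof.
elim: w t => [//|x [//|y B] IH] t /=.
case r: (rule x y) => [f|]; first by case=> <-; exists [::], x, y, B, f.
case E: (if B is _ :: _ then _ else _) => [s|] //= -[<-].
have [A [x' [y' [B' [f [-> rf ->]]]]]] := IH _ E.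
by exists (x :: A), x', y', B', f; rewrite lc_ctx_comp cats0.
Qed.

Lemma irreducible_cons x y w :
  irreducible_word [:: x, y & w] = ~~ isSome (rule x y) && irreducible_word (y :: w).
Proof.
rewrite /irreducible_word /=; case: (rule x y) => //=.
by case: (if w is _ :: _ then _ else _).
Qed.

Lemma lc_evalM A B t :
  word_elt K A * lc_eval t * word_elt K B = lc_eval (lc_ctx A B t).
Proof.
rewrite /lc_eval big_map mulr_sumr mulr_suml; apply: eq_bigr => p _ /=.
by rewrite !word_elt_cat -free_scalerAr -scalerAl mulrA.
Qed.

Variable mu : seq G -> nat.
Hypothesis mu_rule : forall A x y B f p, rule x y = Some f -> p \in f ->
  (mu (A ++ p.2 ++ B) < mu (A ++ x :: y :: B))%N.

Lemma mu_reduce w t p : reduce_word w = Some t -> p \in t -> (mu p.2 < mu w)%N.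
Proof.
move=> /reduce_wordE [A [x [y [B [f [-> rf ->]]]]]] /mapP[p' p'f ->] /=.
exact: mu_rule rf p'f.
Qed.

(** The value [0] for exhausted fuel is never reached from fuel above [mu w], because each reduction
    lowers [mu] strictly; hence the fuel [(mu w).+1] in [nf_word]. *)
Fixpoint nf_fuel n w : F :=
  if n is n'.+1 then
    if reduce_word w is Some t then \sum_(p <- t) ev p.1 *: nf_fuel n' p.2
    else word_elt K w
  else 0.

Lemma nf_fuel_irrelevant n m w :
  (mu w < n)%N -> (mu w < m)%N -> nf_fuel n w = nf_fuel m w.
Proof.
elim: n m w => [//|n IH] [//|m] w; rewrite !ltnS => wn wm /=.
case E: (reduce_word w) => [t|//]; apply: eq_big_seq => p pt.
have lt_pw := mu_reduce E pt.
by rewrite (IH m) // (leq_trans lt_pw).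
Qed.

Definition nf_word w := nf_fuel (mu w).+1 w.

Lemma nf_wordE w : nf_word w =
  if reduce_word w is Some t then \sum_(p <- t) ev p.1 *: nf_word p.2
  else word_elt K w.
Proof.
rewrite {1}/nf_word /=; case E: (reduce_word w) => [t|//].
apply: eq_big_seq => p pt; congr (_ *: _); apply: nf_fuel_irrelevant => //.
exact: mu_reduce pt.
Qed.

Definition nf (u : F) : F :=
  mmap (@malgC {fmonom G} K) (fun m => nf_word (fmonom_val m)) u.

Fact nf_is_additive : additive nf.
Proof. exact: mmap_is_additive. Qed.
HB.instance Definition _ := GRing.isAdditive.Build F F nf nf_is_additive.

Lemma nfZ c u : nf (c *: u) = c *: nf u.
Proof.
rewrite /nf (mmapEw (msuppZ_le c u)) mmapE scaler_sumr.
by apply: eq_bigr => m _; rewrite /= [in LHS]mul_malgC [in RHS]mul_malgC scalerA mcoeffZ.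
Qed.

Lemma nf_word_elt w : nf (word_elt K w) = nf_word w.
Proof. by rewrite /nf mmapU mul1r. Qed.

Lemma nf_lc_eval t : nf (lc_eval t) = \sum_(p <- t) ev p.1 *: nf_word p.2.
Proof.
rewrite raddf_sum; apply: eq_bigr => p _ /=.
by rewrite nfZ nf_word_elt.
Qed.

Definition nf_ctx A B (t : lincomb) : F :=
  \sum_(p <- t) ev p.1 *: nf_word (A ++ p.2 ++ B).

Lemma nf_ctxE A B t :
  nf_ctx A B t = nf (word_elt K A * lc_eval t * word_elt K B).
Proof. by rewrite lc_evalM nf_lc_eval /nf_ctx big_map. Qed.

Lemma nf_ctx_comp A B A' B' t :
  nf_ctx A B (lc_ctx A' B' t) = nf_ctx (A ++ A') (B' ++ B) t.
Proof. by rewrite /nf_ctx big_map; apply: eq_bigr => p _ /=; rewrite -!catA. Qed.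

(** The induction hypothesis of the diamond lemma: below [N], contracting any redex, leftmost or
    not, preserves the normal form. [bounded_lc] states that a combination in context stays in this
    range. *)
Definition sound_below N := forall A x y B f, rule x y = Some f ->
  (mu (A ++ x :: y :: B) < N)%N -> nf_word (A ++ x :: y :: B) = nf_ctx A B f.

Definition bounded_lc N A B (t : lincomb) :=
  forall p, p \in t -> (mu (A ++ p.2 ++ B) < N)%N.

Lemma reduce_lc_bounded N A B t :
  bounded_lc N A B t -> bounded_lc N A B (reduce_lc t).
Proof.
move=> bt p /flatten_mapP[r rt].
case E: (reduce_word r.2) => [s|]; last by rewrite inE => /eqP->; apply: bt.
move=> /mapP[s' s's ->] /=.
have [A' [x [y [B' [f [er rf es]]]]]] := reduce_wordE E.
move: s's; rewrite es => /mapP[r' r'f ->] /=.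
apply: leq_ltn_trans (bt _ rt); rewrite er.
have := mu_rule (A ++ A') (B' ++ B) rf r'f.
by rewrite -!catA => /ltnW.
Qed.

Lemma nf_ctx_reduce N A B t : sound_below N -> bounded_lc N A B t ->
  nf_ctx A B (reduce_lc t) = nf_ctx A B t.
Proof.
move=> sN bt; rewrite /nf_ctx /reduce_lc big_flatten big_map.
apply: eq_big_seq => r rt.
case E: (reduce_word r.2) => [s|]; last by rewrite big_seq1.
have [A' [x [y [B' [f [er rf es]]]]]] := reduce_wordE E.
have -> : A ++ r.2 ++ B = (A ++ A') ++ x :: y :: (B' ++ B) by rewrite er -!catA.
rewrite (sN _ _ _ _ _ rf); last by have := bt r rt; rewrite er -!catA.
rewrite -nf_ctx_comp -es /nf_ctx big_map scaler_sumr.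
by apply: eq_bigr => p _; rewrite /= evM scalerA.
Qed.

Lemma nf_ctx_iter_reduce N A B n t : sound_below N -> bounded_lc N A B t ->
  nf_ctx A B (iter n reduce_lc t) = nf_ctx A B t.
Proof.
move=> sN; elim: n t => [//|n IH] t bt.
by rewrite iterSr IH ?(nf_ctx_reduce sN) //; apply: reduce_lc_bounded.
Qed.

(** Equality is required only after evaluation, as the lists are uncollected. One common [n] is no
    restriction, since irreducible terms are fixed by [reduce_lc]. *)
Hypothesis confluent : forall x y z f g,
  rule x y = Some f -> rule y z = Some g ->
  exists n, lc_eval (iter n reduce_lc (lc_ctx [::] [:: z] f)) =
            lc_eval (iter n reduce_lc (lc_ctx [:: x] [::] g)).

(* Leftmost reduction of w agrees with any other one: by induction on mu when the
   two redexes are disjoint, by confluence when they overlap. *)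
Lemma nf_word_rule N : sound_below N.
Proof.
elim: N => [//|N IH] A x y B f rf; rewrite ltnS leq_eqVlt => /orP[/eqP muN|]; last exact: IH.
have [A' [x' [y' [B' [f' [rf' ew H]]]]]] := reduce_word_redex A B rf.
have -> : nf_word (A ++ x :: y :: B) = nf_ctx A' B' f'.
  by rewrite nf_wordE ew /nf_ctx big_map.
case: H => [[-> ex ey ->]|[eA ey' ->]|[D [eA ->]]].
- by move: rf; rewrite ex ey rf' => -[->].
- subst A y'.
  have [n Hn] := confluent rf' rf.
  have -> : nf_ctx A' (y :: B) f' = nf_ctx A' B (lc_ctx [::] [:: y] f').
    rewrite nf_ctx_comp /= cats0; reflexivity.
  have -> : nf_ctx (rcons A' x') B f = nf_ctx A' B (lc_ctx [:: x'] [::] f).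
    rewrite nf_ctx_comp /= cats1; reflexivity.
  rewrite -(nf_ctx_iter_reduce n IH); last first.
    move=> p /mapP[r rf'r ->]; rewrite -muN cat_rcons.
    by have := mu_rule A' (y :: B) rf' rf'r; rewrite /= -!catA.
  rewrite -[RHS](nf_ctx_iter_reduce n IH); last first.
    move=> p /mapP[r rfr ->]; rewrite -muN.
    by have := mu_rule (rcons A' x') B rf rfr; rewrite /= cat_rcons cats0.
  by rewrite !nf_ctxE Hn.
subst A; rewrite /nf_ctx.
(* For disjoint redexes, contracting both gives the same double sum in either order; after one
   contraction the measure has dropped, so the hypothesis covers the other. *)
transitivity (\sum_(p <- f') \sum_(r <- f)
    (ev p.1 * ev r.1) *: nf_word (A' ++ p.2 ++ D ++ r.2 ++ B)).
  apply: eq_big_seq => p pf'.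
  have := IH (A' ++ p.2 ++ D) x y B f rf; rewrite -!catA => ->; last first.
    by rewrite -muN; have := mu_rule A' (D ++ x :: y :: B) rf' pf'; rewrite -!catA.
  rewrite /nf_ctx scaler_sumr; apply: eq_bigr => r _.
  by rewrite scalerA -!catA.
rewrite exchange_big /=; apply: eq_big_seq => r rfr.
have := IH A' x' y' (D ++ r.2 ++ B) f' rf'; rewrite -!catA /= => ->; last first.
  rewrite -muN; have := mu_rule (A' ++ x' :: y' :: D) B rf rfr.
  by rewrite -!catA.
rewrite /nf_ctx scaler_sumr; apply: eq_bigr => p _.
by rewrite scalerA mulrC.
Qed.

Variable rel : F -> F -> Prop.
(** The two hypotheses make rules and relations generate the same ideal: the first serves spanning,
    the second independence. The scalar [c] is there for the determinant relation, whose leading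
    word does not have coefficient one. *)
Hypothesis rule_rel : forall x y f, rule x y = Some f ->
  in_ideal rel (word_elt K [:: x; y] - lc_eval f).
Hypothesis rel_rule : forall u v, rel u v ->
  exists x y f c, rule x y = Some f /\
    u - v = c *: (word_elt K [:: x; y] - lc_eval f).

Lemma nf_sandwich_sum A B (T : Type) (s : seq T) (c : T -> K) (E : T -> F) :
  nf (word_elt K A * (\sum_(i <- s) c i *: E i) * word_elt K B) =
  \sum_(i <- s) c i *: nf (word_elt K A * E i * word_elt K B).
Proof.
rewrite mulr_sumr mulr_suml raddf_sum; apply: eq_bigr => i _ /=.
by rewrite -free_scalerAr -scalerAl nfZ.
Qed.

(** Quantifying over the context makes the induction close: a factor [w] on either side is expanded
    into words, and each word is absorbed into [A] or [B]. *)
Lemma nf_in_ideal u A B : in_ideal rel u ->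
  nf (word_elt K A * u * word_elt K B) = 0.
Proof.
move=> Iu; elim: Iu A B => {u} [u v uv||u v _ IHu _ IHv|w u _ IH|w u _ IH] A B.
- have [x [y [f [c [rf ->]]]]] := rel_rule uv.
  rewrite -free_scalerAr -scalerAl nfZ mulrBr mulrBl raddfB /=.
  rewrite -(word_elt_cat K A [:: x; y]) -(word_elt_cat K _ B) nf_word_elt.
  rewrite -nf_ctxE -catA.
  by rewrite (nf_word_rule rf (ltnSn _)) subrr scaler0.
- by rewrite mulr0 mul0r raddf0.
- rewrite mulrDr mulrDl raddfD /=.
  exact: etrans (congr2 +%R (IHu A B) (IHv A B)) (addr0 0).
- have -> : w * u = \sum_(m <- msupp w) w@_m *: (word_elt K (fmonom_val m) * u).
    rewrite [in LHS](word_elt_expand w) mulr_suml.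
    by apply: eq_bigr => m _; rewrite scalerAl.
  rewrite nf_sandwich_sum big1 // => m _.
  by rewrite mulrA -(word_elt_cat K A) IH scaler0.
have -> : u * w = \sum_(m <- msupp w) w@_m *: (u * word_elt K (fmonom_val m)).
  rewrite [in LHS](word_elt_expand w) mulr_sumr.
  by apply: eq_bigr => m _; rewrite free_scalerAr.
rewrite nf_sandwich_sum big1 // => m _.
by rewrite mulrA -mulrA -(word_elt_cat K _ B) IH scaler0.
Qed.

Lemma proj_sum (T : Type) (s : seq T) (E : T -> F) :
  proj rel (\sum_(i <- s) E i) = \sum_(i <- s) proj rel (E i).
Proof.
have proj0 : proj rel 0 = 0 by apply: (addrI (proj rel 0)); rewrite -projD !addr0.
by apply: big_morph => //; apply: projD.
Qed.

Variables (I : choiceType) (word : I -> seq G).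
Hypothesis word_inj : injective word.
Hypothesis word_irreducible : forall i, irreducible_word (word i).
Hypothesis irreducible_wordP : forall w, irreducible_word w -> exists i, w = word i.


Lemma proj_redex A x y B f : rule x y = Some f ->
  proj rel (word_elt K (A ++ x :: y :: B)) = proj rel (lc_eval (lc_ctx A B f)).
Proof.
move=> rf; rewrite (word_elt_cat K A) (word_elt_cat K [:: x; y] B) mulrA -lc_evalM.
rewrite [LHS]projM [X in X * _]projM.
have -> : proj rel (word_elt K [:: x; y]) = proj rel (lc_eval f).
  by apply/eqP; rewrite projE; apply/rel_idealP/rule_rel.
by rewrite -projM; symmetry; apply: projM.
Qed.

Lemma proj_word_span w :
  in_span (fun i => proj rel (word_elt K (word i))) (proj rel (word_elt K w)).
Proof.
have [n] := ubnP (mu w); elim: n w => [//|n IH] w; rewrite ltnS => wn.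
case E: (reduce_word w) => [t|]; last first.
  have [i ->] : exists i, w = word i.
    by apply: irreducible_wordP; rewrite /irreducible_word E.
  exact: in_span_gen.
have [A [x [y [B [f [ew rf et]]]]]] := reduce_wordE E.
rewrite ew (proj_redex A B rf) -et proj_sum; apply: in_span_sum => p pt.
rewrite projZ; apply: in_spanZ.
exact: IH _ (leq_trans (mu_reduce E pt) wn).
Qed.

Theorem irreducible_words_basis :
  is_basis (fun i => proj rel (word_elt K (word i))).
Proof.
split=> [s c us /eqP|].
  under eq_bigr do rewrite -projZ.
  rewrite -proj_sum.
  have -> : 0 = proj rel 0 by apply: (addrI (proj rel 0)); rewrite -projD !addr0.
  rewrite projE subr0 => /rel_idealP/(@nf_in_ideal _ [::] [::]).
  rewrite word_elt0 mulr1 mul1r raddf_sum => nf0 j js.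
  (* Distinct irreducible words are independent in the free algebra, so the coefficient at [word j]
     isolates [c j]. *)
  have := congr1 (mcoeff (FMonom (word j))) nf0; rewrite mcoeff0 raddf_sum => <-.
  rewrite (bigD1_seq j) //= big1 ?addr0 => [|i ij].
    rewrite nfZ nf_word_elt nf_wordE (eqP (word_irreducible j)).
    by rewrite mcoeffZ mcoeffUU mulr1.
  rewrite nfZ nf_word_elt nf_wordE (eqP (word_irreducible i)).
  rewrite mcoeffZ mcoeffU; case: eqP => [[/word_inj ei]|_]; last by rewrite mulr0.
  by rewrite ei eqxx in ij.
apply: in_span_spanning => v.
rewrite -[v]projK (word_elt_expand (repr v)) proj_sum.
apply: in_span_sum => m _; rewrite projZ; apply: in_spanZ.
exact: proj_word_span.
Qed.

End Rewriting.

(** * The rules of the torus algebra *)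

Local Notation "1'" := (ord0 : 'I_2).
Local Notation "2'" := (ord_max : 'I_2).

(* (c, e) stands for the Laurent monomial c q^e. *)
Definition lmon : eqType := (int * int)%type.
Definition lmon_mul (c d : lmon) : lmon := (c.1 * d.1, c.2 + d.2).

Definition laurent_mul (s t : seq lmon) : seq lmon :=
  [seq lmon_mul c d | c <- s, d <- t].

Local Notation torus_lc := (seq (lmon * seq torus_gen)).

Definition letter (b : bool) (i j : 'I_2) : torus_gen := (b, (i, j)).

(* 11, 12, 21, 22 have index 0, 1, 2, 3. *)
Definition letter_index (x : torus_gen) : nat := (x.2.1).*2 + x.2.2.

(* The determinant relation is oriented as 12.21 -> q^-2 (11.22 - 1). *)
Definition sl2_rule (b : bool) (x y : torus_gen) : option torus_lc :=
  let x11 := letter b 1' 1' in let x12 := letter b 1' 2' in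
  let x21 := letter b 2' 1' in let x22 := letter b 2' 2' in
  match letter_index x, letter_index y with
  | 1%N, 0%N => Some [:: ((1, 0), [:: x11; x12]); ((1, 0), [:: x12; x22]);
                     ((-1, - 2), [:: x12; x22])]
  | 2%N, 0%N => Some [:: ((1, 0), [:: x11; x21]); ((-1, - 2), [:: x21; x22]);
                     ((1, - 4), [:: x21; x22])]
  | 2%N, 1%N => Some [:: ((1, 0), [:: x12; x21]); ((1, 0), [:: x11; x22]);
                     ((-1, - 2), [:: x11; x22]); ((-1, 0), [:: x22; x22]);
                     ((1, - 2), [:: x22; x22])]
  | 3%N, 0%N => Some [:: ((1, 0), [:: x11; x22])]
  | 3%N, 1%N => Some [:: ((1, 2), [:: x12; x22])]
  | 3%N, 2%N => Some [:: ((1, - 2), [:: x21; x22])]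
  | 1%N, 2%N => Some [:: ((1, - 2), [:: x11; x22]); ((-1, - 2), [::])]
  | _, _ => None
  end.

Definition ltensor (d o e : seq lmon) (i j k l : 'I_2) : seq lmon :=
  if (i == k) && (j == l) then if i == j then d else o
  else if [&& i == 2', j == 1', k == 1' & l == 2'] then e else [::].

(** These are the tensors stripped of their common factor, [sq] for [Rmat] and [sq^-1] for the other
    two. *)
Definition lRmat := ltensor [:: (1, 1)] [:: (1, 0)] [:: (1, 1); (-1, - 1)].
Definition lRinv := ltensor [:: (1, - 1)] [:: (1, 0)] [:: (-1, 1); (1, - 1)].
Definition lRtld :=
  ltensor [:: (1, - 1)] [:: (1, 0)] [:: (1, - 3); (-1, - 1)].

Definition sum2 (E : 'I_2 -> torus_lc) : torus_lc := E 1' ++ E 2'.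

(* The factors sq and sq^-1 of the four tensors cancel, so the coefficients are
   Laurent polynomials in q. *)
Definition cross_lc (g h e f : 'I_2) : torus_lc :=
  sum2 (fun i => sum2 (fun j => sum2 (fun k => sum2 (fun l =>
  sum2 (fun m => sum2 (fun n => sum2 (fun o => sum2 (fun p =>
    [seq (c, [:: letter false l o; letter true p m]) | c <-
      laurent_mul (laurent_mul (laurent_mul (lRtld i e h j) (lRmat g j k l))
        (lRmat m n i f)) (lRinv k o p n)])))))))).

(* The collected form of cross_lc. *)
Definition cross_rule (x y : torus_gen) : torus_lc :=
  let a11 := letter false 1' 1' in let a12 := letter false 1' 2' in
  let a21 := letter false 2' 1' in let a22 := letter false 2' 2' in
  let b11 := letter true 1' 1' in let b12 := letter true 1' 2' in
  let b21 := letter true 2' 1' in let b22 := letter true 2' 2' in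
  match letter_index x, letter_index y with
  | 0%N, 0%N => [:: ((1, 0), [:: a11; b11]); ((- 1, - 2), [:: a21; b12]);
        ((1, - 4), [:: a21; b12])]
  | 0%N, 1%N => [:: ((1, 0), [:: a11; b12]); ((- 1, - 2), [:: a11; b12]);
        ((1, 0), [:: a12; b11]); ((- 1, 0), [:: a22; b12]);
        ((1, - 2), [:: a22; b12])]
  | 0%N, 2%N => [:: ((1, 0), [:: a21; b11])]
  | 0%N, 3%N => [:: ((1, 0), [:: a21; b12]); ((- 1, - 2), [:: a21; b12]);
        ((1, 0), [:: a22; b11])]
  | 1%N, 0%N => [:: ((1, 0), [:: a11; b12])]
  | 1%N, 1%N => [:: ((1, 2), [:: a12; b12])]
  | 1%N, 2%N => [:: ((1, - 2), [:: a21; b12])]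
  | 1%N, 3%N => [:: ((1, 0), [:: a22; b12])]
  | 2%N, 0%N => [:: ((1, 0), [:: a11; b21]); ((1, 0), [:: a21; b11]);
        ((- 1, - 2), [:: a21; b11]); ((- 1, 0), [:: a21; b22]);
        ((1, - 2), [:: a21; b22])]
  | 2%N, 1%N => [:: ((- 1, 0), [:: a11; b11]); ((1, - 2), [:: a11; b11]);
        ((1, 0), [:: a11; b22]); ((- 1, - 2), [:: a11; b22]);
        ((1, - 2), [:: a12; b21]); ((1, 2), [:: a21; b12]);
        ((- 1, 0), [:: a21; b12]); ((- 1, - 2), [:: a21; b12]);
        ((1, - 4), [:: a21; b12]); ((1, 0), [:: a22; b11]);
        ((- 1, - 2), [:: a22; b11]); ((- 1, 0), [:: a22; b22]);
        ((1, - 2), [:: a22; b22])]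
  | 2%N, 2%N => [:: ((1, 2), [:: a21; b21])]
  | 2%N, 3%N => [:: ((- 1, 2), [:: a21; b11]); ((1, 0), [:: a21; b11]);
        ((1, 2), [:: a21; b22]); ((- 1, 0), [:: a21; b22]);
        ((1, 0), [:: a22; b21])]
  | 3%N, 0%N => [:: ((1, 0), [:: a11; b22]); ((1, 0), [:: a21; b12]);
        ((- 1, - 2), [:: a21; b12])]
  | 3%N, 1%N => [:: ((- 1, 2), [:: a11; b12]); ((1, 0), [:: a11; b12]);
        ((1, 0), [:: a12; b22]); ((1, 2), [:: a22; b12]);
        ((- 1, 0), [:: a22; b12])]
  | 3%N, 2%N => [:: ((1, 0), [:: a21; b22])]
  | 3%N, 3%N => [:: ((- 1, 2), [:: a21; b12]); ((1, 0), [:: a21; b12]);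
        ((1, 0), [:: a22; b22])]
  | _, _ => [::]
  end.

Definition torus_rule (x y : torus_gen) : option torus_lc :=
  match x.1, y.1 with
  | true, false => Some (cross_rule x y)
  | false, true => None
  | b, _ => sl2_rule b x y
  end.

Definition torus_gens : seq torus_gen :=
  [seq letter b p.1 p.2 | b <- [:: false; true],
    p <- [:: (1', 1'); (1', 2'); (2', 1'); (2', 2')]].

Fixpoint insert_term (p : lmon * seq torus_gen) (t : torus_lc) : torus_lc :=
  if t is r :: t' then
    if (r.1.2 == p.1.2) && (r.2 == p.2) then ((r.1.1 + p.1.1, r.1.2), r.2) :: t'
    else r :: insert_term p t'
  else [:: p].

(** Like terms are merged with [q] treated as an indeterminate, so a successful test remains valid
    for every specialisation of [q] to a nonzero scalar. *)
Definition lc_is0 (t : torus_lc) :=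
  all (fun p => p.1.1 == 0) (foldr insert_term [::] t).

Definition lc_eqb (t s : torus_lc) := lc_is0 (t ++ lc_scale lmon_mul (-1, 0) s).

Definition overlap_ok n (x y z : torus_gen) : bool :=
  if torus_rule x y is Some f then
    if torus_rule y z is Some g then
      lc_eqb (iter n (reduce_lc lmon_mul torus_rule) (lc_ctx [::] [:: z] f))
             (iter n (reduce_lc lmon_mul torus_rule) (lc_ctx [:: x] [::] g))
    else true
  else true.


Definition overlaps_ok n := all (fun x => all (fun y => all (fun z =>
  overlap_ok n x y z) torus_gens) torus_gens) torus_gens.

(** Certifies the table [cross_rule] against the tensor formula, so that overlaps can be reduced
    with the short collected lists. *)
Definition cross_ok := all (fun p => all (fun r =>
  lc_eqb (cross_lc p.1 p.2 r.1 r.2) (cross_rule (letter true p.1 p.2) (letter false r.1 r.2)))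
  [:: (1', 1'); (1', 2'); (2', 1'); (2', 2')])
  [:: (1', 1'); (1', 2'); (2', 1'); (2', 2')].

Lemma mem_torus_gens (x : torus_gen) : x \in torus_gens.
Proof. by case: x => [[] [[[|[|//]] i] [[|[|//]] j]]]. Qed.

(** * Evaluation of the symbolic combinations in the field *)

Section Eval.
Variables (K : fieldType) (q : K).
Hypothesis q_neq0 : q != 0.
Local Notation F := (free_alg K torus_gen).

Definition lmon_eval (c : lmon) : K := c.1%:~R * q ^ c.2.
Local Notation eval := (lc_eval (G := torus_gen) lmon_eval).

Lemma lmon_evalM c d : lmon_eval (lmon_mul c d) = lmon_eval c * lmon_eval d.
Proof. by rewrite /lmon_eval /= expfzDr // intrM mulrACA. Qed.

Lemma laurent_mul_eval s t :
  \sum_(c <- laurent_mul s t) lmon_eval c =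
  (\sum_(c <- s) lmon_eval c) * (\sum_(c <- t) lmon_eval c).
Proof.
rewrite /laurent_mul big_allpairs_dep mulr_suml; apply: eq_bigr => c _.
by rewrite mulr_sumr; apply: eq_bigr => d _; rewrite lmon_evalM.
Qed.

Lemma lc_eval_cat t s : eval (t ++ s) = eval t + eval s.
Proof. exact: big_cat. Qed.

Lemma lc_eval_cons p t : eval (p :: t) = lmon_eval p.1 *: word_elt K p.2 + eval t.
Proof. exact: big_cons. Qed.

Lemma lc_eval_scale c t : eval (lc_scale lmon_mul c t) = lmon_eval c *: eval t.
Proof.
rewrite /lc_eval big_map scaler_sumr; apply: eq_bigr => p _.
by rewrite lmon_evalM scalerA.
Qed.

Lemma lc_eval_insert p t :
  eval (insert_term p t) = lmon_eval p.1 *: word_elt K p.2 + eval t.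
Proof.
elim: t => [|r t IH] /=; first exact: lc_eval_cons.
case: ifP => [/andP[/eqP e2 /eqP ew]|_]; rewrite !lc_eval_cons /=.
  have -> : lmon_eval (r.1.1 + p.1.1, r.1.2) = lmon_eval r.1 + lmon_eval p.1.
    by rewrite /lmon_eval /= intrD mulrDl e2.
  have scaleDCA (V : lmodType K) (a b : K) (v w : V) :
      (a + b) *: v + w = b *: v + (a *: v + w) by rewrite scalerDl addrAC addrC.
  by rewrite -ew; apply: scaleDCA.
rewrite IH; exact: addrCA.
Qed.

Lemma lc_is0P t : lc_is0 t -> eval t = 0.
Proof.
have -> : eval t = eval (foldr insert_term [::] t).
  by elim: t => [//|p t IH] /=; rewrite lc_eval_insert lc_eval_cons IH.
rewrite /lc_is0 => /allP t0; rewrite /lc_eval big_seq big1 // => p /t0 /eqP p0.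
by rewrite /lmon_eval p0 mul0r scale0r.
Qed.

Lemma lc_eqbP t s : lc_eqb t s -> eval t = eval s.
Proof.
move=> /lc_is0P; rewrite lc_eval_cat lc_eval_scale => ts0.
apply/eqP; rewrite -subr_eq0; apply/eqP; rewrite -[RHS]ts0.
by congr (_ + _); rewrite /lmon_eval expr0z mulr1 scaleN1r.
Qed.

Lemma torus_rule_confluent (x y z : torus_gen) f g :
  torus_rule x y = Some f -> torus_rule y z = Some g ->
  exists n, eval (iter n (reduce_lc lmon_mul torus_rule) (lc_ctx [::] [:: z] f)) =
            eval (iter n (reduce_lc lmon_mul torus_rule) (lc_ctx [:: x] [::] g)).
Proof.
(* Four rounds of simultaneous reduction join all overlaps among the eight letters, as the
   computation below confirms. *)
move=> rf rg; exists 4%N; apply: lc_eqbP.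
have : overlaps_ok 4 by vm_compute.
move=> /allP/(_ x (mem_torus_gens x))/allP/(_ y (mem_torus_gens y)).
by move=> /allP/(_ z (mem_torus_gens z)); rewrite /overlap_ok rf rg.
Qed.

Lemma sum2_eval E : eval (sum2 E) = \sum_i eval (E i).
Proof.
rewrite lc_eval_cat 2!big_ord_recl big_ord0 addr0.
by congr (_ + eval (E _)); apply/val_inj.
Qed.

Variable sq : K.
Hypothesis sq_neq0 : sq != 0.

Lemma ltensor_eval a d o e i j k l :
  tensor4 (a * \sum_(c <- d) lmon_eval c) (a * \sum_(c <- o) lmon_eval c)
    (a * \sum_(c <- e) lmon_eval c) i j k l =
  a * \sum_(c <- ltensor d o e i j k l) lmon_eval c.
Proof.
rewrite /tensor4 /ltensor; case: ifP => _; first by case: ifP.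
by case: ifP => _ //; rewrite big_nil mulr0.
Qed.

Lemma Rmat_eval i j k l :
  Rmat q sq i j k l = sq * \sum_(c <- lRmat i j k l) lmon_eval c.
Proof.
rewrite -ltensor_eval /Rmat !big_cons !big_nil /lmon_eval /=.
by rewrite !addr0 !mul1r expr0z expr1z mulN1r mulr1.
Qed.

Lemma Rinv_eval i j k l :
  Rinv q sq i j k l = sq^-1 * \sum_(c <- lRinv i j k l) lmon_eval c.
Proof.
rewrite -ltensor_eval /Rinv !big_cons !big_nil /lmon_eval /=.
by rewrite !addr0 !mul1r expr0z expr1z mulN1r mulr1 -mulrN opprB addrC.
Qed.

Lemma Rtld_eval i j k l :
  Rtld q sq i j k l = sq^-1 * \sum_(c <- lRtld i j k l) lmon_eval c.
Proof.
rewrite -ltensor_eval /Rtld !big_cons !big_nil /lmon_eval /=.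
rewrite !addr0 !mul1r expr0z mulN1r mulr1; congr tensor4.
rewrite -mulrA; congr (_ * _); rewrite mulrBr.
change (q ^ (- 3)) with (q ^- 3); change (q ^ (-1)) with (q^-1).
by field.
Qed.

Lemma free_gen2 (x y : torus_gen) :
  free_gen K x * free_gen K y = word_elt K [:: x; y].
Proof. by rewrite !free_genE -word_elt_cat. Qed.

Lemma cross_lc_eval g h e f :
  \sum_i \sum_j \sum_k \sum_l \sum_m \sum_n \sum_o \sum_p
     (Rtld q sq i e h j * Rmat q sq g j k l * Rmat q sq m n i f * Rinv q sq k o p n)
       *: (fa K l o * fb K p m) = eval (cross_lc g h e f).
Proof.
rewrite /cross_lc; do 8![rewrite sum2_eval; apply: eq_bigr => ? _].
rewrite Rtld_eval !Rmat_eval Rinv_eval /fa /fb free_gen2 /lc_eval big_map /=.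
rewrite -scaler_suml; congr (_ *: _).
rewrite !laurent_mul_eval; set a := \sum_(c <- _) _; set b := \sum_(c <- _) _.
set c := \sum_(c <- _) _; set d := \sum_(c <- _) _.
by field.
Qed.

Lemma cross_rule_eval g h e f :
  eval (cross_rule (letter true g h) (letter false e f)) = eval (cross_lc g h e f).
Proof.
symmetry; apply: lc_eqbP.
have : cross_ok by vm_compute.
have in4 (i j : 'I_2) : (i, j) \in [:: (1', 1'); (1', 2'); (2', 1'); (2', 2')].
  by case: i j => [[|[|//]] i] [[|[|//]] j].
by move=> /allP/(_ (g, h) (in4 g h))/allP/(_ (e, f) (in4 e f)).
Qed.

End Eval.

(** * Termination and irreducible words *)

(* Termination by a polynomial interpretation: a letter acts on nat as a strictly
   increasing function, and each rule decreases the composite function on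
   positive arguments, hence decreases the measure in any context. *)
Definition letter_weight (x : torus_gen) (n : nat) : nat :=
  if x.1 then (nth 0 [:: 5; 4; 3; 2] (letter_index x) * n ^ 4)%N
  else nth 0%N [:: 3 * n + 1; 4 * n + 1; 5 * n + 1; 2 * n]%N (letter_index x).

Definition torus_measure (w : seq torus_gen) : nat := foldr letter_weight 1%N w.

Variant letter_spec : torus_gen -> Prop :=
| Letter_a11 : letter_spec (letter false 1' 1')
| Letter_a12 : letter_spec (letter false 1' 2')
| Letter_a21 : letter_spec (letter false 2' 1')
| Letter_a22 : letter_spec (letter false 2' 2')
| Letter_b11 : letter_spec (letter true 1' 1')
| Letter_b12 : letter_spec (letter true 1' 2')
| Letter_b21 : letter_spec (letter true 2' 1')
| Letter_b22 : letter_spec (letter true 2' 2').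

Lemma letterP x : letter_spec x.
Proof.
have o2 (i : 'I_2) : (i == 1') || (i == 2') by case: i => [[|[|]]].
case: x => b [i j]; have /orP[/eqP->|/eqP->] := o2 i;
  by have /orP[/eqP->|/eqP->] := o2 j; case: b; constructor.
Qed.

Lemma letter_weight_gt0 x n : (0 < n)%N -> (0 < letter_weight x n)%N.
Proof.
by move=> n0; case: (letterP x); rewrite /letter_weight /= ?addn1 ?muln_gt0 ?expn_gt0 ?n0.
Qed.

Lemma letter_weight_mono x m n : (m < n)%N -> (letter_weight x m < letter_weight x n)%N.
Proof.
move=> mn; have mn4 : (m ^ 4 < n ^ 4)%N by rewrite ltn_exp2r.
by case: (letterP x); rewrite /letter_weight /= ?ltn_add2r ltn_pmul2l.
Qed.

(** Two [a] letters compose to an affine map: swapping them keeps the slope, and the constant terms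
    decide. Two [b] letters with factors [c] and [d] give [c * d ^ 4 * n ^ 16], so the factor of the
    right letter dominates. For [b] before [a] the value is at least [32 * n ^ 4], while every word
    on the right of a cross rule gives at most [25 * n ^ 4 + 1]. *)
Lemma torus_rule_weight x y f n p : torus_rule x y = Some f -> p \in f -> (0 < n)%N ->
  (foldr letter_weight n p.2 < letter_weight x (letter_weight y n))%N.
Proof.
move=> rf pf n0; move: p pf; apply/allP.
have n4 : (n <= n ^ 4)%N by rewrite -{1}(expn1 n) leq_pexp2l.
(* Handles the empty word produced by the determinant rule for [b]. *)
have n16 : (n <= n ^ 4 * (n ^ 4 * (n ^ 4 * n ^ 4)))%N.
  by rewrite -!expnD -{1}(expn1 n) leq_pexp2l.
(* Bounds [b] applied to an [a] letter of slope 3, 4 or 5; slope 2 has no constant term and is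
   exact. Once [n ^ 4] and [n ^ 16] are abstracted, all goals are linear. *)
have n2 k : (1 < k)%N -> (16 * n ^ 4 <= (k * n + 1) ^ 4)%N.
  by move=> k2; rewrite -[16%N]/(2 ^ 4)%N -expnMn leq_exp2r //; nia.
have := n2 5%N isT; have := n2 4%N isT; have {n2} := n2 3%N isT.
case: (letterP x) rf; case: (letterP y) => //= -[<-] /=; rewrite ?andbT;
  repeat (apply/andP; split); rewrite /letter_weight /= ?expnMn;
  move: (n ^ 4)%N n4 n16 => N4 n4;
  move: (N4 * (N4 * (N4 * N4)))%N => N16 n16 h3 h4 h5; lia.
Qed.

Lemma torus_measure_rule A x y B f p : torus_rule x y = Some f -> p \in f ->
  (torus_measure (A ++ p.2 ++ B) < torus_measure (A ++ x :: y :: B))%N.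
Proof.
move=> rf pf; elim: A => [|a A IH] /=; last exact: letter_weight_mono.
rewrite /torus_measure foldr_cat; apply: torus_rule_weight rf pf _.
by elim: B => //= b B IH; apply: letter_weight_gt0.
Qed.

(** A partial order: each [a] is below each [b], and within a family [11] is below [12] and [21],
    which are below [22]. The letters [12] and [21] are incomparable, since both of their products
    are reducible. Transitivity turns the local condition of irreducibility into sortedness. *)
Definition letter_le (x y : torus_gen) : bool := ~~ isSome (torus_rule x y).

Lemma letter_le_trans : transitive letter_le.
Proof.
by move=> y x z; case: (letterP x); case: (letterP y) => //; case: (letterP z).
Qed.

Lemma letter_le_anti : antisymmetric letter_le.
Proof. by move=> x y; case: (letterP x); case: (letterP y). Qed.

Lemma letter_le_refl : reflexive letter_le.
Proof. by move=> x; case: (letterP x). Qed.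

Lemma irreducible_sorted w : irreducible_word torus_rule w = sorted letter_le w.
Proof.
elim: w => [//|x [//|y w] IH]; rewrite irreducible_cons IH //=.
Qed.

Definition sl2_word (b : bool) (n : sl2_exponent) : seq torus_gen :=
  let: (alpha, beta, gamma, delta) := val n in
  nseq alpha (letter b 1' 1') ++ nseq beta (letter b 1' 2') ++
  nseq gamma (letter b 2' 1') ++ nseq delta (letter b 2' 2').

Definition torus_word (n : sl2_exponent * sl2_exponent) : seq torus_gen :=
  sl2_word false n.1 ++ sl2_word true n.2.

Definition exponent_letter (b : bool) (n : sl2_exponent) (x : torus_gen) : nat :=
  if x.1 == b then
    let: (alpha, beta, gamma, delta) := val n in
    nth 0%N [:: alpha; beta; gamma; delta] (letter_index x)
  else 0.

Lemma count_sl2_word b n x : count_mem x (sl2_word b n) = exponent_letter b n x.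
Proof.
case: n => [[[[al be] ga] de] h]; rewrite /sl2_word /exponent_letter /=.
by rewrite !count_cat !count_nseq; case: (letterP x); case: b => /=; lia.
Qed.

Lemma torus_word_inj : injective torus_word.
Proof.
move=> [n1 n2] [m1 m2] /(congr1 (fun w x => count_mem x w)) E.
have {}E x : (exponent_letter false n1 x + exponent_letter true n2 x =
              exponent_letter false m1 x + exponent_letter true m2 x)%N.
  by rewrite -!count_sl2_word -!count_cat; exact: (congr1 (@^~ x) E).
have := E (letter false 1' 1'); have := E (letter false 1' 2').
have := E (letter false 2' 1'); have := E (letter false 2' 2').
have := E (letter true 1' 1'); have := E (letter true 1' 2').
have := E (letter true 2' 1'); have := E (letter true 2' 2').
case: n1 n2 m1 m2 {E} => [[[[? ?] ?] ?] ?] [[[[? ?] ?] ?] ?] [[[[? ?] ?] ?] ?] [[[[? ?] ?] ?] ?].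
rewrite /exponent_letter /= !addn0 !add0n => ? ? ? ? ? ? ? ?.
by congr pair; apply/val_inj; congr (_, _, _, _).
Qed.

Lemma pairwise_nseq (T : Type) (r : rel T) k x : reflexive r -> pairwise r (nseq k x).
Proof. by move=> rr; elim: k => //= k ->; rewrite all_nseq rr orbT. Qed.

Lemma torus_word_irreducible n : irreducible_word torus_rule (torus_word n).
Proof.
rewrite irreducible_sorted (sorted_pairwise letter_le_trans).
case: n => [[[[[al be] ga] de] h] [[[[al' be'] ga'] de'] h']].
rewrite /torus_word /sl2_word /= !pairwise_cat !allrel_catl !allrel_catr.
rewrite !(pairwise_nseq _ _ letter_le_refl).
(* The only incomparable blocks are [12] and [21] of one family, and the exponent condition makes
   one of them empty. *)
have nn (k l : nat) x y : letter_le x y || (k == 0%N) || (l == 0%N) ->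
    allrel letter_le (nseq k x) (nseq l y).
  by rewrite /allrel all_nseq /= all_nseq => /orP[/orP[->|->]|->]; rewrite ?orbT.
by rewrite !nn.
Qed.

Lemma irreducible_torus_word w :
  irreducible_word torus_rule w -> exists n, w = torus_word n.
Proof.
rewrite irreducible_sorted => sw.
pose c b i j := count_mem (letter b i j) w.
(* Any two letters of a sorted word are comparable, which excludes [12] together with [21]. *)
have cP b : (c b 1' 2' == 0%N) || (c b 2' 1' == 0%N).
  apply/negPn/negP; rewrite negb_or -!lt0n /c -2!has_count 2!has_pred1.
  move=> /andP[w12 w21].
  have le := sorted_leq_index letter_le_trans letter_le_refl sw.
  have := leq_total (index (letter b 1' 2') w) (index (letter b 2' 1') w).
  by case/orP => [/(le _ _ w12 w21)|/(le _ _ w21 w12)]; case: (b).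
pose n b : sl2_exponent := exist _ (c b 1' 1', c b 1' 2', c b 2' 1', c b 2' 2') (cP b).
exists (n false, n true).
(* A sorted word is determined by its letter counts. *)
apply: (sorted_eq letter_le_trans letter_le_anti sw).
  by rewrite -irreducible_sorted torus_word_irreducible.
apply/allP => x _; rewrite /= count_cat !count_sl2_word /exponent_letter /=.
by case: (letterP x); rewrite /= /c ?addn0.
Qed.


(** * Matching the defining relations with the rules *)

Section ModuleIdentities.
Variables (K : fieldType) (V : lmodType K).
Implicit Types (a e : K) (w : V).

(** The right sides of these identities have the shape of an unfolded [lc_eval]: a final [0], and a
    coefficient such as [1 - q ^- 2] split into two Laurent monomials on the same word. *)
Lemma relator_swap e w1 w2 : e = 1 -> w1 - w2 = 1 *: (w1 - (e *: w2 + 0)).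
Proof. by move=> ->; rewrite !scale1r addr0. Qed.

Lemma relator_monomial a e w1 w2 :
  e = a -> w1 - a *: w2 = 1 *: (w1 - (e *: w2 + 0)).
Proof. by move=> ->; rewrite scale1r addr0. Qed.

Lemma relator_binomial a e1 e2 e3 w1 w2 w3 : e1 = 1 -> e2 + e3 = a ->
  w1 - (w2 + a *: w3) = 1 *: (w1 - (e1 *: w2 + (e2 *: w3 + (e3 *: w3 + 0)))).
Proof. by move=> -> <-; rewrite !scale1r addr0 scalerDl. Qed.

Lemma relator_trinomial a e1 e2 e3 e4 e5 w1 w2 w3 w4 :
    e1 = 1 -> e2 + e3 = a -> e4 + e5 = - a ->
  w1 - (w2 + a *: (w3 - w4)) =
  1 *: (w1 - (e1 *: w2 + (e2 *: w3 + (e3 *: w3 + (e4 *: w4 + (e5 *: w4 + 0)))))).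
Proof.
move=> -> e23 e45; rewrite !scale1r addr0 -(scalerDl w4) e45.
by rewrite [e2 *: w3 + _]addrA -scalerDl e23 scalerBr scaleNr.
Qed.

(** Solves the determinant relation for [w1], the word [12 21], with [a] equal to [q ^+ 2]; this is
    the one rule whose scalar differs from one. *)
Lemma relator_det a e1 e2 w1 w2 w3 : a != 0 -> e1 = a^-1 -> e2 = - a^-1 ->
  w3 - (w2 + a *: w1) = (- a) *: (w1 - (e1 *: w3 + (e2 *: w2 + 0))).
Proof.
move=> a0 -> ->; rewrite addr0 scalerBr scalerDr !scalerA !mulNr mulrN divff //.
rewrite opprK scaleN1r scale1r scaleNr [in RHS]opprD opprK [RHS]addrC.
by rewrite opprD addrA.
Qed.

End ModuleIdentities.

Section TorusBasis.
Variables (K : fieldType) (q sq : K).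
Hypotheses (q_neq0 : q != 0) (sq_neq0 : sq != 0).
Local Notation F := (free_alg K torus_gen).
Local Notation eval := (lc_eval (G := torus_gen) (lmon_eval q)).
Local Notation rel := (torus_rel q sq).

Definition gen_matrix (b : bool) (i j : 'I_2) : F := free_gen K (letter b i j).

(* The relation u = v is, up to a nonzero scalar, the rule x y -> f. *)
Definition relator_of x y (f : seq (lmon * seq torus_gen)) (u v : F) :=
  exists c : K, c != 0 /\ u - v = c *: (word_elt K [:: x; y] - eval f).

Definition relates x y (u v : F) :=
  exists f, torus_rule x y = Some f /\ relator_of x y f u v.

Ltac relator c id :=
  eexists; split; [reflexivity|]; exists c; split; [|
  rewrite /gen_matrix -?word_elt0 !free_gen2 /lc_eval !big_cons big_nil; apply: id;
  rewrite /lmon_eval /= ?mul1r ?mulN1r ?expr0z].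

Section Sl2Relators.
Variable b : bool.
Local Notation x := (gen_matrix b).
Local Notation l := (letter b).

Lemma relates_12_11 : relates (l 1' 2') (l 1' 1') (x 1' 2' * x 1' 1')
  (x 1' 1' * x 1' 2' + (1 - q ^- 2) *: (x 1' 2' * x 2' 2')).
Proof.
by case: b; relator (1 : K) (@relator_binomial K F) => //; exact: oner_neq0.
Qed.

Lemma relates_21_11 : relates (l 2' 1') (l 1' 1') (x 2' 1' * x 1' 1')
  (x 1' 1' * x 2' 1' - (q ^- 2 * (1 - q ^- 2)) *: (x 2' 1' * x 2' 2')).
Proof.
have e : - q ^- 2 + q ^- 4 = - (q ^- 2 * (1 - q ^- 2)) by field.
rewrite -scaleNr.
by case: b; relator (1 : K) (@relator_binomial K F) => //; exact: oner_neq0.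
Qed.

Lemma relates_21_12 : relates (l 2' 1') (l 1' 2') (x 2' 1' * x 1' 2')
  (x 1' 2' * x 2' 1' + (1 - q ^- 2) *: (x 1' 1' * x 2' 2' - x 2' 2' * x 2' 2')).
Proof.
have e : -1 + q ^- 2 = - (1 - q ^- 2) by rewrite opprB addrC.
by case: b; relator (1 : K) (@relator_trinomial K F) => //; exact: oner_neq0.
Qed.

Lemma relates_22_11 : relates (l 2' 2') (l 1' 1') (x 2' 2' * x 1' 1')
  (x 1' 1' * x 2' 2').
Proof.
by case: b; relator (1 : K) (@relator_swap K F) => //; exact: oner_neq0.
Qed.

Lemma relates_22_12 : relates (l 2' 2') (l 1' 2') (x 2' 2' * x 1' 2')
  (q ^+ 2 *: (x 1' 2' * x 2' 2')).
Proof.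
by case: b; relator (1 : K) (@relator_monomial K F) => //; exact: oner_neq0.
Qed.

Lemma relates_22_21 : relates (l 2' 2') (l 2' 1') (x 2' 2' * x 2' 1')
  (q ^- 2 *: (x 2' 1' * x 2' 2')).
Proof.
by case: b; relator (1 : K) (@relator_monomial K F) => //; exact: oner_neq0.
Qed.

Lemma relates_12_21 : relates (l 1' 2') (l 2' 1') (x 1' 1' * x 2' 2')
  (1 + q ^+ 2 *: (x 1' 2' * x 2' 1')).
Proof.
have q2 : q ^+ 2 != 0 by rewrite expf_neq0.
by case: b; relator (- q ^+ 2) (@relator_det K F); rewrite ?oppr_eq0.
Qed.

End Sl2Relators.

Lemma sl2_rel_relates b u v : sl2_rel q (gen_matrix b) u v ->
  exists x y, relates x y u v.
Proof.
by case; do 2 eexists; [apply: relates_12_11 | apply: relates_21_11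
  | apply: relates_21_12 | apply: relates_22_11 | apply: relates_22_12
  | apply: relates_22_21 | apply: relates_12_21].
Qed.

Lemma sl2_rule_relates b i j k l f :
  torus_rule (letter b i j) (letter b k l) = Some f ->
  exists u v, sl2_rel q (gen_matrix b) u v /\
    relates (letter b i j) (letter b k l) u v.
Proof.
have I2 (m : 'I_2) : m = 1' \/ m = 2'.
  by case: m => [[|[|//]] m]; [left | right]; apply/val_inj.
have [->|->] := I2 i; have [->|->] := I2 j; have [->|->] := I2 k;
  have [->|->] := I2 l; try by case: b.
- by do 2 eexists; split; [apply: sl2_rel_12_11 | apply: relates_12_11].
- by do 2 eexists; split; [apply: sl2_rel_det | apply: relates_12_21].
- by do 2 eexists; split; [apply: sl2_rel_21_11 | apply: relates_21_11].
- by do 2 eexists; split; [apply: sl2_rel_21_12 | apply: relates_21_12].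
- by do 2 eexists; split; [apply: sl2_rel_22_11 | apply: relates_22_11].
- by do 2 eexists; split; [apply: sl2_rel_22_12 | apply: relates_22_12].
- by do 2 eexists; split; [apply: sl2_rel_22_21 | apply: relates_22_21].
Qed.

Lemma cross_relates g h e f : relates (letter true g h) (letter false e f)
  (fb K g h * fa K e f)
  (\sum_i \sum_j \sum_k \sum_l \sum_m \sum_n \sum_o \sum_p
     (Rtld q sq i e h j * Rmat q sq g j k l * Rmat q sq m n i f * Rinv q sq k o p n)
       *: (fa K l o * fb K p m)).
Proof.
eexists; split; first by [].
exists 1; split; first exact: oner_neq0.
by rewrite scale1r cross_lc_eval // cross_rule_eval // /fb /fa free_gen2.
Qed.

Lemma torus_rel_relates u v : rel u v -> exists x y, relates x y u v.
Proof.
case=> {u v} [u v uv|u v uv|g h e f].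
- exact: (@sl2_rel_relates false).
- exact: (@sl2_rel_relates true).
- by do 2 eexists; apply: cross_relates.
Qed.

Lemma torus_rule_relates x y f : torus_rule x y = Some f ->
  exists u v, rel u v /\ relator_of x y f u v.
Proof.
move=> rf; suff [u [v [uv [f' []]]]] : exists u v, rel u v /\ relates x y u v.
  by rewrite rf => -[->]; exists u, v.
case: x y rf => [[] [i j]] [[] [k l]] rf; last first.
- have [u [v [uv r]]] := sl2_rule_relates rf.
  by exists u, v; split=> //; apply: torus_rel_a.
- by [].
- by do 2 eexists; split; [apply: torus_rel_ba | apply: cross_relates].
have [u [v [uv r]]] := sl2_rule_relates rf.
by exists u, v; split=> //; apply: torus_rel_b.
Qed.

Lemma torus_rule_in_ideal x y f : torus_rule x y = Some f ->
  in_ideal rel (word_elt K [:: x; y] - eval f).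
Proof.
move=> /torus_rule_relates [u [v [uv [c [c0 e]]]]].
(* Division by [c] is written as a product because [in_ideal] is closed under multiplication by
   elements of the free algebra. *)
have -> : word_elt K [:: x; y] - eval f = (c^-1 *: 1) * (u - v).
  by rewrite e -[RHS]scalerAl mul1r scalerA mulVf // scale1r.
exact/in_idealMl/in_ideal_rel.
Qed.

Lemma proj_letterX b i j k :
  proj rel (word_elt K (nseq k (letter b i j))) = proj rel (gen_matrix b i j) ^+ k.
Proof.
elim: k => [|k IH]; first by rewrite word_elt0 proj1 expr0.
by rewrite exprS -IH -[RHS]projM /gen_matrix free_genE -word_elt_cat.
Qed.

Lemma proj_sl2_word b n : proj rel (word_elt K (sl2_word b n)) =
  sl2_monomial (fun i j => proj rel (gen_matrix b i j)) n.
Proof.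
case: n => [[[[al be] ga] de] h]; rewrite /sl2_word /sl2_monomial /=.
rewrite -!proj_letterX 3!word_elt_cat [LHS]projM.
rewrite [X in _ * X]projM [X in _ * (_ * X)]projM.
by rewrite -!mulrA.
Qed.

Lemma pbw_monomialE n :
  pbw_monomial q sq n = proj rel (word_elt K (torus_word n)).
Proof. by rewrite /torus_word word_elt_cat [RHS]projM !proj_sl2_word. Qed.

Theorem torus_pbw_basis : is_basis (@pbw_monomial K q sq).
Proof.
rewrite (_ : @pbw_monomial K q sq = fun n => proj rel (word_elt K (torus_word n))).
  apply: (irreducible_words_basis (lmon_evalM q_neq0) torus_measure_rule
    (torus_rule_confluent q_neq0) torus_rule_in_ideal _ torus_word_inj
    torus_word_irreducible irreducible_torus_word).
  move=> u v /torus_rel_relates [x [y [f [rf [c [_ e]]]]]].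
  by exists x, y, f, c.
by apply/funext => n; rewrite pbw_monomialE.
Qed.

End TorusBasis.

Theorem proposition2p8 (R : realType) (q sq : R[i])
  (q_neq0 : q != 0) (sqE : sq ^+ 2 = q) (q_generic : generic q) :
  is_basis (@pbw_monomial R[i] q sq).
Proof.
apply: torus_pbw_basis => //; apply: contraNneq q_neq0 => sq0.
by rewrite -sqE sq0 expr0n.
Qed.
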